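(* Let $h$ satisfy the assumption in the context and $\alpha>0$. For every $x\in\mathbb R$ and every player $i$, $$\lim_{N\to\infty}v^i_{(N)}(x,x,\dots,x)=v^*(x),$$ where $v^i_{(N)}$ is the NE value of player $i$ in the $N$-player fuel follower game and $v^*$ is the NE value of the mean field game with initial distribution $\mu_{0-}=\delta_x$ (Dirac mass at $x$), both as specified in the context.
   Context: **Assumption on $h$.** $h:\mathbb R\to\mathbb R$ is convex, symmetric (even), twice differentiable, $h(0)\ge0$, $h''$ decreasing (weakly) on $\mathbb R^+$, $0<k<h''(x)\le K$ for constants $K>k>0$. $B$ is a standard one-dimensional Brownian motion. **Constants.** $p_1(x)=\mathbb E\int_0^\infty e^{-\alpha t}h(x+B_t)dt$ and, for $N\ge2$, $p_N(x)=\mathbb E\int_0^\infty e^{-\alpha t}h\big(\frac{N-1}{N}(x+\sqrt{\frac N{N-1}}B_t)\big)dt$. $c>0$ is the unique positive solution of $\frac1{\sqrt{2\alpha}}\tanh(c\sqrt{2\alpha})=\frac{p_1'(c)-1}{p_1''(c)}$, and $c_N>0$ the unique positive solution of $\frac{1}{\sqrt{2(N-1)\alpha/N}}\tanh\big(c_N\sqrt{\frac{2(N-1)\alpha}{N}}\big)=\frac{p_N'(c_N)-1}{p_N''(c_N)}$. **$N$-player NE value.** In the $N$-player game, player $i$ with position $X^i_t=x^i+B^i_t+\xi^{i,+}_t-\xi^{i,-}_t$ minimizes $\mathbb E\int_0^\infty e^{-\alpha t}[h(X^i_t-\frac1N\sum_jX^j_t)dt+d\xi^{i,+}_t+d\xi^{i,-}_t]$.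 $v^i_{(N)}$ is the value associated with the threshold-type Nash equilibrium with threshold $c_N$; on the common waiting region $\{\pmb x\in\mathbb R^N:|x^l-\frac{\sum_{j\ne l}x^j}{N-1}|<c_N,\ l=1,\dots,N\}$ it is given by $$v^i_{(N)}(\pmb x)=-\frac{p_N''(c_N)\cosh\Big(\sqrt{\frac{2(N-1)\alpha}{N}}\big(x^i-\frac{\sum_{j\ne i}x^j}{N-1}\big)\Big)}{\frac{2(N-1)\alpha}{N}\cosh\Big(c_N\sqrt{\frac{2(N-1)\alpha}{N}}\Big)}+p_N\Big(x^i-\frac{\sum_{j\ne i}x^j}{N-1}\Big).$$ **Mean field game NE value.** In the mean field game a representative player with $dX_t=dB_t+d\xi^+_t-d\xi^-_t$, $X_{0-}\sim\mu_{0-}$, minimizes $\mathbb E\int_0^\infty e^{-\alpha t}[h(X_t-m_t)dt+d\xi^+_t+d\xi^-_t]$, $m_t$ being in equilibrium the mean of $X_t$. With $m_{0-}=\int y\,\mu_{0-}(dy)$, the NE value is $$v^*(y)=-\frac{p_1''(c)\cosh((y-m_{0-})\sqrt{2\alpha})}{2\alpha\cosh(c\sqrt{2\alpha})}+p_1(y-m_{0-})\quad\text{for } m_{0-}\le y\le m_{0-}+c,$$ $v^*(y)=v^*(m_{0-}+c)+(y-m_{0-}-c)$ for $y\ge m_{0-}+c$, and $v^*(y)=v^*(2m_{0-}-y)$ for $y<m_{0-}$. For $\mu_{0-}=\delta_x$, $m_{0-}=x$. *)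

(* Defs.v *)
From HB Require Import structures.
From mathcomp Require Import all_boot all_order all_algebra.
From mathcomp Require Import all_classical all_reals all_analysis.

Set Implicit Arguments.
Unset Strict Implicit.
Unset Printing Implicit Defensive.

Import Order.TTheory GRing.Theory Num.Theory.
Import numFieldNormedType.Exports.

Local Open Scope classical_set_scope.
Local Open Scope ring_scope.

Definition cosh (R : realType) (x : R) : R := (expR x + expR (- x)) / 2.

Definition sinh (R : realType) (x : R) : R := (expR x - expR (- x)) / 2.

Definition tanh (R : realType) (x : R) : R := sinh x / cosh x.

(* Only the times t >= 0 are constrained.  [normal_prob m s] takes the standard
   deviation [s]; for [s = 0] it is not a Dirac mass, hence the strict [s < t]. *)
Definition brownian_motion (d : measure_display) (Omega : measurableType d)
    (R : realType) (P : probability Omega R) (B : R -> {RV P >-> R}) : Prop :=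
  [/\ {ae P, forall w, B 0 w = 0},
      forall (n : nat) (t : nat -> R) (A : nat -> set R),
        0 <= t 0%N -> (forall j, t j <= t j.+1) ->
        (forall j, measurable (A j)) ->
        P (\bigcap_(j in `I_n) [set w | A j (B (t j.+1) w - B (t j) w)])
        = (\prod_(j < n) P [set w | A j (B (t j.+1) w - B (t j) w)%R])%E,
      forall (s t : R) (A : set R), 0 <= s -> s < t -> measurable A ->
        P [set w | A (B t w - B s w)] = normal_prob 0 (Num.sqrt (t - s)) A
    & {ae P, forall w, {within `[0, +oo[, continuous (fun t => B t w)}}].

Definition cost_assumption (R : realType) (h : R -> R) : Prop :=
  [/\ convex_function [set: R^o] (h : R^o -> R^o),
      forall x, h (- x) = h x,
      forall x, derivable h x 1 /\ derivable (derive1 h) x 1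
    & 0 <= h 0] /\
  [/\ forall x y, 0 < x -> x <= y -> derive1n 2 h y <= derive1n 2 h x
    & exists k K : R, [/\ 0 < k, k < K & forall x, k < derive1n 2 h x <= K]].

Section potentials.
Context (d : measure_display) (Omega : measurableType d) (R : realType).
Context (P : probability Omega R) (B : R -> {RV P >-> R}).
Context (alpha : R) (h : R -> R).

(* The integrands are nonnegative (h is even and convex with h 0 >= 0) and the
   iterated integral is finite under [cost_assumption], so [fine] loses nothing. *)
Definition p1 (x : R) : R :=
  fine (\int[P]_w \int[lebesgue_measure]_(t in `[0%R, +oo[)
          (expR (- (alpha * t)) * h (x + B t w))%:E)%E.

Definition pN (N : nat) (x : R) : R :=
  fine (\int[P]_w \int[lebesgue_measure]_(t in `[0%R, +oo[)
          (expR (- (alpha * t)) *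
           h ((N%:R - 1) / N%:R *
              (x + Num.sqrt (N%:R / (N%:R - 1)) * B t w)))%:E)%E.

End potentials.

Definition rateN (R : realType) (alpha : R) (N : nat) : R :=
  2 * (N%:R - 1) * alpha / N%:R.

(* The mean field game corresponds to beta = 2 alpha and p = p1, the N-player
   game to beta = rateN alpha N and p = pN N. *)
Definition positive_threshold (R : realType) (beta : R) (p : R -> R) (c : R)
    : Prop :=
  0 < c /\
  (Num.sqrt beta)^-1 * tanh (c * Num.sqrt beta)
  = (derive1 p c - 1) / derive1n 2 p c.

(* The value inside the waiting region, as a function of the signed distance z
   to the target. *)
Definition waiting_value (R : realType) (beta : R) (p : R -> R) (c z : R) : R :=
  - (derive1n 2 p c * cosh (z * Num.sqrt beta))
    / (beta * cosh (c * Num.sqrt beta))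
  + p z.

Definition gap (R : realType) (N : nat) (x : 'rV[R]_N) (i : 'I_N) : R :=
  x 0 i - (\sum_(j < N | j != i) x 0 j) / (N%:R - 1).

Definition waiting_region (R : realType) (N : nat) (c : R) : set 'rV[R]_N :=
  [set x | forall l : 'I_N, `|gap x l| < c].

Definition mean (R : realType) (mu : probability R R) : R :=
  (\int[mu]_(y in [set: R]) y)%R.

Section mfg_value.
Context (R : realType) (alpha : R) (p : R -> R) (c : R) (mu : probability R R).

Definition mfg_value_right (y : R) : R :=
  if y <= mean mu + c then waiting_value (2 * alpha) p c (y - mean mu)
  else waiting_value (2 * alpha) p c c + (y - mean mu - c).

Definition mfg_value (y : R) : R :=
  if mean mu <= y then mfg_value_right y
  else mfg_value_right (2 * mean mu - y).

End mfg_value.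

(* Main.v *)
(* Let nu be the product of P with Lebesgue measure, w = exp(-alpha t) 1_{t >= 0}
   and Y a jointly measurable modification of B. By Tonelli, with a = (N-1)/N,
     p_N(x) = \int w h(a x + sqrt a Y) dnu,
   and p_1 is the case a = 1, so p_N, p_N', p_N'' are given by integrals that
   depend continuously on (a, x), by dominated convergence (h, h', h'' grow at
   most quadratically and w Y^2 is integrable). The threshold c_N is the unique
   positive zero of
     G_N(x) = tanh(x sqrt b_N) / sqrt b_N * p_N''(x) - (p_N'(x) - 1),
   b_N = 2 a alpha. Since Y is symmetric, p_1'(0) = 0, so the limit G_1 is
   positive at 0; it is negative near +oo because p_1'' is bounded and bounded
   away from 0. Hence G_1 changes sign at c, so c_N -> c and the value at the
   diagonal, where the gap is 0, converges. *)

Require Import Defs.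
From HB Require Import structures.
From mathcomp Require Import all_boot all_order all_algebra.
From mathcomp Require Import all_classical all_reals all_analysis.
From mathcomp Require Import measurable_realfun lra ring.

Set Implicit Arguments.
Unset Strict Implicit.
Unset Printing Implicit Defensive.

Import Order.TTheory GRing.Theory Num.Theory.
Import numFieldNormedType.Exports.

Local Open Scope classical_set_scope.
Local Open Scope ring_scope.

(** * Derivatives: mean values, parity, and continuity of a monotone derivative *)

Lemma derivable_mvt (R : realType) (f : R -> R) (a b : R) :
  (forall x, derivable f x 1) -> a < b ->
  exists2 x, a < x < b & f b - f a = derive1 f x * (b - a).
Proof.
move=> df ab.
have [||x xab ->] := @MVT R f (derive1 f) a b ab.
- by move=> x _; rewrite derive1E; exact/derivableP.
- apply: continuous_subspaceT => x; apply: differentiable_continuous.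
  exact/derivable1_diffP.
- by exists x => //; move: xab; rewrite in_itv.
Qed.

Lemma derivable_compN (R : realType) (f : R -> R) :
  (forall x, derivable f x 1) ->
  forall x, derivable (f \o -%R) x 1 /\
            derive1 (f \o -%R) x = - derive1 f (- x).
Proof.
move=> df x.
have : is_derive x (1 : R) (f \o -%R) (derive1 f (- x) * -1).
  apply: is_derive1_comp.
  by rewrite derive1E; exact/derivableP.
by case=> dfN fE; rewrite derive1E fE mulrN1.
Qed.

Lemma derive1_even (R : realType) (f : R -> R) :
  (forall x, derivable f x 1) -> (forall x, f (- x) = f x) ->
  forall x, derive1 f (- x) = - derive1 f x.
Proof.
move=> df fe x.
have E : f = f \o -%R by apply/funext => z /=; rewrite fe.
by rewrite {2}E; have [_ ->] := derivable_compN df x; rewrite opprK.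
Qed.

Lemma derive1_odd (R : realType) (f : R -> R) :
  (forall x, derivable f x 1) -> (forall x, f (- x) = - f x) ->
  forall x, derive1 f (- x) = derive1 f x.
Proof.
move=> df fo x.
have E : f = - f \o -%R by apply/funext => z /=; rewrite !fctE fo opprK.
have dN z : derivable (- f) z 1 by exact: derivableN.
rewrite [in RHS]E; have [_ ->] := derivable_compN dN x.
by rewrite derive1N// opprK.
Qed.

(** By the mean value theorem, difference quotients on the right of [x] are values of [derive1 f] at
    points just right of [x], and they tend to [derive1 f x]. So a derivative cannot jump. *)
Lemma derive1_approx_right (R : realType) (f : R -> R) (x d e : R) :
  (forall z, derivable f z 1) -> 0 < d -> 0 < e ->
  exists2 y, x < y < x + d & `|derive1 f y - derive1 f x| < e.
Proof.
move=> df d0 e0.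
have : h^-1 *: (f (h + x) - f x) @[h --> 0^'] --> derive1 f x.
  have /cvg_ex[l hl] := df x.
  under eq_fun => h do rewrite -[X in f (X + _)]mulr1.
  rewrite (_ : derive1 f x = l)// derive1E; exact/cvg_lim.
move=> /cvg_dnbhs_at_right/cvgrPdist_lt/(_ _ e0) H.
near (0 : R)^'+ => h.
have h0 : 0 < h by near: h; exact: nbhs_right_gt.
have hd : h < d by near: h; exact: nbhs_right_lt.
have xhx : x < h + x by rewrite ltrDr.
have [y /andP[xy yh] E] := derivable_mvt df xhx.
exists y; first by rewrite xy/= (lt_trans yh)// addrC ltrD2l.
have : `|derive1 f x - h^-1 *: (f (h + x) - f x)| < e by near: h.
by rewrite E addrK /GRing.scale/= mulrCA mulVf ?gt_eqF// mulr1 distrC.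
Unshelve. all: by end_near. Qed.

Lemma derive1_approx_left (R : realType) (f : R -> R) (x d e : R) :
  (forall z, derivable f z 1) -> 0 < d -> 0 < e ->
  exists2 y, x - d < y < x & `|derive1 f y - derive1 f x| < e.
Proof.
move=> df d0 e0; have /all_and2[dg gE] := derivable_compN df.
have [y /andP[xy yx] H] := @derive1_approx_right R (f \o -%R) (- x) d e dg d0 e0.
exists (- y); first by apply/andP; split; lra.
by move: H; rewrite !gE !opprK -normrN opprD !opprK.
Qed.

(** A monotone function can only have jump discontinuities, and a derivative has none. Evenness
    carries continuity over to the negative half-line. *)
Lemma continuous_monotone_derive1 (R : realType) (f : R -> R) :
  (forall x, derivable f x 1) ->
  (forall x, derive1 f (- x) = derive1 f x) ->
  (forall x y, 0 < x -> x <= y -> derive1 f y <= derive1 f x) ->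
  continuous (derive1 f).
Proof.
move=> df fe fm.
(* Monotonicity is assumed from positive points on; the value at 0 is reached through nearby values
   on its right. *)
have le0 z : 0 < z -> derive1 f z <= derive1 f 0.
  move=> z0; apply/ler_addgt0Pr => e e0.
  have [y /andP[y0 yz]] := @derive1_approx_right R f 0 z e df z0 e0.
  rewrite ltr_norml => /andP[_ H].
  have := fm y z y0; rewrite add0r in yz; move=> /(_ (ltW yz)).
  by move: H; lra.
have {}fm x y : 0 <= x -> x <= y -> derive1 f y <= derive1 f x.
  rewrite le_eqVlt => /predU1P[<-|x0]; last exact: fm.
  by rewrite le_eqVlt => /predU1P[<-//|]; exact: le0.
have pos (x : R) : 0 <= x -> derive1 f @ nbhs x --> derive1 f x.
  move=> x0; apply/cvgrPdist_lt => e e0.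
  have [y /andP[xy _] Hy] := @derive1_approx_right R f x 1 e df ltr01 e0.
  have {}Hy : derive1 f x - derive1 f y < e.
    by move: Hy; rewrite ltr_norml => /andP[]; lra.
  (* At 0 there is no monotone bracket on the left; evenness replaces [z] by [|z|], so the right
     bracket suffices. *)
  move: x0; rewrite le_eqVlt => /predU1P[x0|x0].
    rewrite -x0 in Hy *.
    near=> z.
    have zy : `|z| <= y.
      rewrite ler_norml; apply/andP; split; apply: ltW; near: z.
        by apply: lt_nbhsr; lra.
      by apply: lt_nbhsl; lra.
    have -> : derive1 f z = derive1 f `|z|.
      by case: (ger0P z) => // _; rewrite fe.
    have := fm `|z| y (normr_ge0 _) zy.
    have := fm 0 `|z| (lexx _) (normr_ge0 _).
    by move=> H1 H2; rewrite ger0_norm; lra.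
  have [w /andP[xw wx] Hw] := @derive1_approx_left R f x x e df x0 e0.
  have {}Hw : derive1 f w - derive1 f x < e.
    by move: Hw; rewrite ltr_norml => /andP[]; lra.
  rewrite subrr in xw.
  near=> z.
  have zy : z < y by near: z; exact: lt_nbhsl.
  have wz : w < z by near: z; exact: lt_nbhsr.
  have [xz|zx] := leP x z.
    have := fm x z (ltW x0) xz; have := fm z y (le_trans (ltW x0) xz) (ltW zy).
    by move=> H1 H2; rewrite ger0_norm; lra.
  have := fm z x (ltW (lt_trans xw wz)) (ltW zx).
  have := fm w z (ltW xw) (ltW wz).
  by move=> H1 H2; rewrite ler0_norm; lra.
move=> x; have [|x0] := leP 0 x; first exact: pos.
apply/cvgrPdist_lt => e e0.
have nx0 : 0 <= - x by lra.
have := pos (- x) nx0; rewrite fe => /cvgrPdist_lt/(_ _ e0).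
move=> /nbhs_ballP[d /= d0 Hd]; apply/nbhs_ballP; exists d => //= z xz.
by have /= := Hd (- z); rewrite fe; apply; rewrite /ball/= -opprD normrN.
Unshelve. all: by end_near. Qed.

(** * Quantitative consequences of the cost assumption *)

(** Continuity of the second derivative comes from its monotonicity on the positive half-line. The
    lower quadratic bound on [h] later turns finiteness of the potential into a second moment. *)
Lemma cost_assumptionP (R : realType) (h : R -> R) : cost_assumption h ->
  exists k K : R, 0 < k /\
  [/\ forall x, derivable h x 1, forall x, derivable (derive1 h) x 1,
     continuous (derive1n 2 h), forall x, derive1 h (- x) = - derive1 h x &
     [/\ forall x, k <= derive1n 2 h x <= K,
         forall x, `|derive1 h x| <= K * `|x|,
         forall x, h x <= h 0 + K * x ^+ 2 &
         forall x, k / 4 * x ^+ 2 <= h x]].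
Proof.
case=> -[hconv hev hder h0] [hmon [k [K [k0 kK hk]]]].
have /all_and2[dh dh'] := hder.
have h'odd := derive1_even dh hev.
have h''ev := derive1_odd dh' h'odd.
have h'0 : derive1 h 0 = 0.
  by have := h'odd 0; rewrite oppr0 => /eqP; rewrite -addr_eq0 -mulr2n mulrn_eq0/= => /eqP.
have h'inc x y : x <= y ->
    k * (y - x) <= derive1 h y - derive1 h x <= K * (y - x).
  rewrite le_eqVlt => /predU1P[->|xy]; first by rewrite !subrr !mulr0 lexx.
  have [z _ ->] := derivable_mvt dh' xy.
  have /andP[kz zK] := hk z.
  by rewrite !ler_pM2r ?subr_gt0// (ltW kz) zK.
have h'K x : 0 <= x -> 0 <= derive1 h x <= K * x.
  move=> x0; have := h'inc 0 x x0; rewrite h'0 !subr0 => /andP[H1 ->].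
  by rewrite (le_trans _ H1)// mulr_ge0// ltW.
have hpos x : 0 <= x -> 0 <= h x.
  rewrite le_eqVlt => /predU1P[<-//|x0].
  have [z /andP[z0 _] E] := derivable_mvt dh x0.
  have /andP[? _] := h'K z (ltW z0).
  by rewrite -(subrK (h 0) (h x)) addr_ge0// E mulr_ge0// subr0 ltW.
have ch'' := continuous_monotone_derive1 dh' h''ev hmon.
exists k, K; split; first exact: k0.
split; [exact: dh|exact: dh'|exact: ch''|exact: h'odd|split].
- by move=> x; have /andP[/ltW -> ->] := hk x.
- move=> x; have [x0|x0] := leP 0 x.
    by have /andP[? ?] := h'K x x0; rewrite !ger0_norm.
  have /h'K : 0 <= - x by lra.
  by rewrite h'odd => /andP[? ?]; rewrite !ler0_norm; lra.
- suff pos x : 0 < x -> h x <= h 0 + K * x ^+ 2.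
    move=> x; have [x0|x0|<-] := ltgtP 0 x; [exact: pos| |].
      by rewrite -hev -sqrrN; apply: pos; lra.
    by rewrite expr0n mulr0 addr0.
  move=> x0; have [z /andP[z0 zx]] := derivable_mvt dh x0.
  have /andP[_ H] := h'K z (ltW z0); rewrite subr0 => E.
  rewrite -lerBlDl E expr2 mulrA ler_wpM2r ?(ltW x0)//.
  by rewrite (le_trans H)// ler_wpM2l ?(ltW zx)// (le_trans (ltW k0))// ltW.
- suff pos x : 0 < x -> k / 4 * x ^+ 2 <= h x.
    move=> x; have [x0|x0|<-] := ltgtP 0 x; [exact: pos| |].
      by rewrite -hev -sqrrN; apply: pos; lra.
    by rewrite expr0n mulr0.
  (* On [[x / 2, x]] the slope is at least [k * (x / 2)] and the length is [x / 2]; their product is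
     the claimed bound, as [h (x / 2)] is nonnegative. *)
  move=> x0; have x2 : x / 2 < x by lra.
  have [z /andP[z0 zx] E] := derivable_mvt dh x2.
  have /h'inc : 0 <= z by lra.
  rewrite h'0 !subr0 => /andP[H _].
  have := hpos (x / 2) ltac:(lra).
  have : k * (x / 2) <= derive1 h z by apply: le_trans H; rewrite ler_wpM2l// ltW.
  by nra.
Qed.

(** * Weighted potentials and their dependence on shift and scale *)

Definition quadratic_growth (R : realType) (f : R -> R) : Prop :=
  exists C : R, forall x, `|f x| <= C * (1 + x ^+ 2).

(** With [w] the discount and [Y] a Brownian path, this is the expected discounted integral of [f]
    along the path scaled by [s] and started at [b]. Keeping [b] and [s] separate covers [p1], [pN]
    and, up to constant factors, their derivatives. *)
Definition potential (d : measure_display) (T : measurableType d)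
    (R : realType) (nu : {measure set T -> \bar R}) (w Y : T -> R)
    (f : R -> R) (b s : R) : R :=
  \int[nu]_y (w y * f (b + s * Y y)).

Section potential.
Context (d : measure_display) (T : measurableType d) (R : realType).
Context (nu : {measure set T -> \bar R}) (w Y : T -> R).
Hypotheses (mw : measurable_fun [set: T] w) (mY : measurable_fun [set: T] Y).
Hypothesis w_ge0 : forall y, 0 <= w y.
Hypothesis iw : nu.-integrable [set: T] (EFin \o w).
Hypothesis iwY2 : nu.-integrable [set: T] (EFin \o (fun y => w y * Y y ^+ 2)).

Local Notation pot := (potential nu w Y).

(** An integrable majorant, uniform in [|b| <= M] and [|s| <= M], coming from [(b + s * Y) ^+ 2 <= 2
    * b ^+ 2 + 2 * s ^+ 2 * Y ^+ 2]. *)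
Let bound (C M : R) y := C * (1 + 2 * M ^+ 2) * w y + C * (2 * M ^+ 2) * (w y * Y y ^+ 2).

Let integrable_bound C M : nu.-integrable [set: T] (EFin \o bound C M).
Proof.
rewrite (_ : _ \o _ = (fun y => (C * (1 + 2 * M ^+ 2))%:E * (w y)%:E +
  (C * (2 * M ^+ 2))%:E * (w y * Y y ^+ 2)%:E)%E)//.
by apply: integrableD => //; apply: integrableZl.
Qed.

Let le_bound f (C M b s : R) y : (forall x, `|f x| <= C * (1 + x ^+ 2)) ->
  `|b| <= M -> `|s| <= M -> `|w y * f (b + s * Y y)| <= bound C M y.
Proof.
move=> fC bM sM.
have C0 : 0 <= C.
  have := le_trans (normr_ge0 _) (fC 0).
  by rewrite expr0n/= addr0 mulr1.
have M0 : 0 <= M by exact: le_trans bM.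
have sq (z : R) : `|z| <= M -> z ^+ 2 <= M ^+ 2.
  by move=> zM; rewrite -real_normK ?num_real// ler_sqr ?nnegrE.
have : (b + s * Y y) ^+ 2 <= 2 * M ^+ 2 + 2 * M ^+ 2 * Y y ^+ 2.
  have := sq _ bM; have := sq _ sM => H1 H2.
  have : s ^+ 2 * Y y ^+ 2 <= M ^+ 2 * Y y ^+ 2 by rewrite ler_wpM2r ?sqr_ge0.
  have := sqr_ge0 (b - s * Y y).
  by nra.
move=> H; rewrite normrM ger0_norm//.
apply: (@le_trans _ _ (w y * (C * (1 + (2 * M ^+ 2 + 2 * M ^+ 2 * Y y ^+ 2))))).
  apply: ler_wpM2l => //; apply: le_trans (fC _) _.
  by rewrite ler_wpM2l// lerD2l.
by rewrite /bound le_eqVlt; apply/orP; left; apply/eqP; ring.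
Qed.

Let measurable_integrand f b s : measurable_fun [set: R] f ->
  measurable_fun [set: T] (fun y => w y * f (b + s * Y y)).
Proof.
move=> mf; apply: measurable_funM => //.
apply: (measurableT_comp mf).
by apply: measurable_funD => //; exact: measurable_funM.
Qed.

Lemma integrable_potential f b s : measurable_fun [set: R] f ->
  quadratic_growth f ->
  nu.-integrable [set: T] (EFin \o (fun y => w y * f (b + s * Y y))).
Proof.
move=> mf [C fC].
apply: (le_integrable _ _ _ (integrable_bound C (Num.max `|b| `|s|))) => //.
  exact/measurable_EFinP/measurable_integrand.
move=> y _ /=; rewrite lee_fin.
rewrite (le_trans (le_bound y fC _ _) (ler_norm _))//.
- by rewrite le_max lexx.
- by rewrite le_max lexx orbT.
Qed.

(** Convergent parameters are bounded, so a single [bound C M] dominates all the integrands. *)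
Lemma cvg_potential f (b s : nat -> R) (b0 s0 : R) :
  continuous f -> quadratic_growth f ->
  b n @[n --> \oo] --> b0 -> s n @[n --> \oo] --> s0 ->
  pot f (b n) (s n) @[n --> \oo] --> pot f b0 s0.
Proof.
move=> cf gf bb0 ss0; have mf := continuous_measurable_fun cf.
have [C fC] := gf.
have /cvg_seq_bounded/pinfty_ex_gt0[M1 M10 /= bM] : cvgn b.
  by apply/cvg_ex; exists b0.
have /cvg_seq_bounded/pinfty_ex_gt0[M2 M20 /= sM] : cvgn s.
  by apply/cvg_ex; exists s0.
pose M := M1 + M2.
have bound_n y n : `|w y * f (b n + s n * Y y)| <= bound C M y.
  apply: le_bound => //.
    by apply: le_trans (bM n I) _; rewrite lerDl ltW.
  by apply: le_trans (sM n I) _; rewrite lerDr ltW.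
have cvg_y y : (w y * f (b n + s n * Y y))%:E @[n --> \oo] -->
    (w y * f (b0 + s0 * Y y))%:E.
  apply: cvg_EFin; first exact: nearW.
  apply: cvgM; first exact: cvg_cst.
  apply: (cvg_comp _ f); last exact: cf.
  by apply: cvgD => //; apply: cvgM => //; exact: cvg_cst.
have m_n b' s' : measurable_fun [set: T] (fun y => (w y * f (b' + s' * Y y))%:E).
  exact/measurable_EFinP/measurable_integrand.
have ub : {ae nu, forall y n, [set: T] y ->
    (`|(w y * f (b n + s n * Y y))%:E| <= (EFin \o bound C M) y)%E}.
  by apply/aeW => y n _; rewrite lee_fin.
have [_ _ H] := @dominated_convergence _ _ _ nu [set: T] measurableT
  (fun n y => (w y * f (b n + s n * Y y))%:E)
  (fun y => (w y * f (b0 + s0 * Y y))%:E) (EFin \o bound C M)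
  (fun n => m_n _ _) (m_n _ _) (aeW _ (fun y _ => cvg_y y)) (integrable_bound C M) ub.
apply: fine_cvg; rewrite fineK//.
by apply: integrable_fin_num => //; exact: integrable_potential.
Qed.

(** Differentiation under the integral sign; the outer factor [b] is the chain rule for the shift
    [b * x]. *)
Lemma is_derive_potential (f : R -> R) (b s x : R) :
  (forall z, derivable f z 1) -> continuous (derive1 f) ->
  quadratic_growth f -> quadratic_growth (derive1 f) ->
  is_derive x (1 : R) (fun x => pot f (b * x) s)
    (b * pot (derive1 f) (b * x) s).
Proof.
move=> df cf' gf [C fC].
have mf : measurable_fun [set: R] f.
  apply: continuous_measurable_fun => z; apply: differentiable_continuous.
  exact/derivable1_diffP.
have dF y u : is_derive u (1 : R) (fun x => w y * f (b * x + s * Y y))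
    (w y * (b * derive1 f (b * u + s * Y y))).
  have : is_derive u (1 : R) (fun x : R => b * x + s * Y y) b.
    have -> : (fun x : R => b * x + s * Y y) = b *: (id : R -> R) + cst (s * Y y).
      by apply/funext.
    by apply: is_derive_eq; rewrite addr0 -[RHS]mulr1.
  move=> Hl; rewrite -[w y * (_ * _)]/(w y *: (b * _)).
  apply: (@is_deriveZ _ R^o _ (fun x : R => f (b * x + s * Y y))).
  have Hf : is_derive (b * u + s * Y y) (1 : R) f (derive1 f (b * u + s * Y y)).
    by rewrite derive1E; exact/derivableP.
  have := @is_derive1_comp R f (fun x : R => b * x + s * Y y) u _ b Hf Hl.
  by rewrite [_ * b]mulrC.
have D1E y u : partial1of2 (fun x z => w z * f (b * x + s * Y z)) u y =
    w y * (b * derive1 f (b * u + s * Y y)).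
  by rewrite partial1of2E; case: (dF y u).
(* [M] dominates both [|b * u|], for [u] within 1 of [x], and [|s|]. *)
pose M := `|b| * (`|x| + 1) + `|s|.
have Ix : `]x - 1, x + 1[%classic x by rewrite /= in_itv/=; apply/andP; split; lra.
have intf u : `]x - 1, x + 1[%classic u ->
    nu.-integrable [set: T] (EFin \o (fun y => w y * f (b * u + s * Y y))).
  by move=> _; exact: integrable_potential.
have M0 : `|0 : R| <= M by rewrite normr0 addr_ge0// mulr_ge0// addr_ge0.
(* The majorant bounds an absolute value, here taken at zero shift and zero scale. *)
have G0 y : 0 <= `|b| * bound C M y.
  by rewrite mulr_ge0// (le_trans (normr_ge0 _) (le_bound y fC M0 M0)).
have iG : nu.-integrable [set: T] (EFin \o (fun y => `|b| * bound C M y)).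
  have := integrableZl measurableT (`|b|) (integrable_bound C M).
  exact.
have Gub u y : `]x - 1, x + 1[%classic u -> [set: T] y ->
    `|partial1of2 (fun x z => w z * f (b * x + s * Y z)) u y| <= `|b| * bound C M y.
  rewrite /= in_itv/= => /andP[u1 u2] _; rewrite D1E mulrCA normrM.
  apply: ler_wpM2l => //; apply: le_bound => //; last first.
    by rewrite /M lerDr mulr_ge0// addr_ge0.
  rewrite normrM /M -[leLHS]addr0 lerD// ler_wpM2l//.
  rewrite ler_norml; have := ler_norm x; have := ler_norm (- x).
  by rewrite normrN => ? ?; apply/andP; split; lra.
have dP := @derivable_under_integral R d T nu
  (fun x y => w y * f (b * x + s * Y y)) [set: T] measurableT x (x - 1) (x + 1)
  Ix intf (fun u y _ _ => @ex_derive _ _ _ _ _ _ _ (dF y u)) _ G0 iG Gub.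
apply: DeriveDef; first exact: dP.
rewrite -derive1E (@differentiation_under_integral R d T nu
  (fun x y => w y * f (b * x + s * Y y)) [set: T] measurableT x (x - 1) (x + 1)
  Ix intf (fun u y _ _ => @ex_derive _ _ _ _ _ _ _ (dF y u)) _ G0 iG Gub).
rewrite /potential -RintegralZl//; last first.
  by apply: integrable_potential; [exact: continuous_measurable_fun|exists C].
by apply: eq_Rintegral => y _; rewrite D1E mulrCA.
Qed.

Lemma potential_le f g b s : measurable_fun [set: R] f ->
  measurable_fun [set: R] g -> quadratic_growth f -> quadratic_growth g ->
  (forall z, f z <= g z) -> pot f b s <= pot g b s.
Proof.
move=> mf mg gf gg fg; apply: le_Rintegral => //.
- exact: integrable_potential.
- exact: integrable_potential.
- by move=> y _; rewrite ler_wpM2l.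
Qed.

Lemma potential_cst k b s : pot (cst k) b s = k * \int[nu]_y w y.
Proof.
by rewrite -RintegralZl//; apply: eq_Rintegral => y _; rewrite mulrC.
Qed.

End potential.

(** * Convergence of unique zeros *)

Lemma ivt_zero (R : realType) (f : R -> R) (a b : R) :
  continuous f -> a < b -> 0 < f a -> f b < 0 -> exists2 z, a < z < b & f z = 0.
Proof.
move=> cf ab fa fb.
have [||z] := @IVT R f a b 0 (ltW ab).
- exact: continuous_subspaceT.
- by rewrite ge_min le_max (ltW fa) (ltW fb) orbT.
rewrite in_itv/= => /andP[az zb] fz; exists z => //; apply/andP; split.
  by rewrite lt_neqAle az andbT; apply: contraTneq fa => ->; rewrite fz ltxx.
by rewrite lt_neqAle zb andbT; apply: contraTneq fb => <-; rewrite fz ltxx.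
Qed.

(* Only pointwise convergence is needed: [g] changes sign at its unique zero
   [c], so [gn n] changes sign between [c - e] and [c + e] for large [n], and
   the zero produced there must be [cn n]. *)
Lemma cvg_unique_zero (R : realType) (g : R -> R) (gn : nat -> R -> R)
    (c : R) (cn : nat -> R) :
  continuous g -> (forall n, continuous (gn n)) ->
  0 < g 0 -> (exists M, forall x, M < x -> g x < 0) ->
  (forall x, 0 < x -> gn n x @[n --> \oo] --> g x) ->
  0 < c -> (forall x, 0 < x -> g x = 0 -> x = c) ->
  (forall n x, 0 < x -> gn n x = 0 -> x = cn n) ->
  cn n @[n --> \oo] --> c.
Proof.
move=> cg cgn g0 [M gM] cvg_gn c0 gc gnc.
have g_gt0 y : 0 < y -> y < c -> 0 < g y.
  move=> y0 yc; case: (ltgtP 0 (g y)) => // [gy|gy].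
    have [z /andP[z0 zy] gz] := ivt_zero cg y0 g0 gy.
    by have zc := gc z z0 gz; lra.
  by move: (gc y y0 (esym gy)) yc => ->; rewrite ltxx.
have g_lt0 y : c < y -> g y < 0.
  move=> cy; have y0 := lt_trans c0 cy.
  case: (ltgtP (g y) 0) => // [gy|gy]; last first.
    by move: (gc y y0 gy) cy => ->; rewrite ltxx.
  (* A point beyond both [y] and [M]: [g] is negative there, so [g y > 0] would force a zero beyond
     [c]. *)
  have yM : y < Num.max M y + 1 by rewrite ltr_pwDr// le_max lexx orbT.
  have MM : M < Num.max M y + 1 by rewrite ltr_pwDr// le_max lexx.
  have [z /andP[yz _] gz] := ivt_zero cg yM gy (gM _ MM).
  by have zc := gc z (lt_trans y0 yz) gz; lra.
apply/cvgrPdist_lt => e e0.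
(* The bracket from [c - d] to [c + d] lies within [e] of [c] and inside the positive half-line,
   where zeros are unique. *)
pose d := Num.min (e / 2) (c / 2).
have d0 : 0 < d by rewrite lt_min !divr_gt0.
have de : d < e by rewrite gt_min; apply/orP; left; lra.
have dc : d < c by rewrite gt_min; apply/orP; right; lra.
have cd0 : 0 < c - d by lra.
have cd0' : 0 < c + d by lra.
have gl : 0 < g (c - d) by apply: g_gt0 => //; lra.
have gr : g (c + d) < 0 by apply: g_lt0; lra.
near=> n.
have gnl : 0 < gn n (c - d).
  by near: n; exact: (cvgr_gt _ (cvg_gn _ cd0) _ gl).
have gnr : gn n (c + d) < 0.
  by near: n; exact: (cvgr_lt _ (cvg_gn _ cd0') _ gr).
have dd : c - d < c + d by lra.
have [z /andP[z1 z2] gz] := ivt_zero (cgn n) dd gnl gnr.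
by rewrite -(gnc n z (lt_trans cd0 z1) gz) ltr_norml; apply/andP; split; lra.
Unshelve. all: by end_near. Qed.

(** * Hyperbolic functions, and continuity and growth of the cost *)

Lemma cosh_gt0 (R : realType) (x : R) : 0 < cosh x.
Proof. by rewrite divr_gt0// addr_gt0// expR_gt0. Qed.

Lemma continuous_cosh (R : realType) : continuous (@cosh R).
Proof.
move=> x; apply: cvgM; last exact: cvg_cst.
apply: cvgD; first exact: continuous_expR.
by apply: (cvg_comp _ expR); [by apply: (@cvgN _ R^o); exact: cvg_id|exact: continuous_expR].
Qed.

Lemma continuous_sinh (R : realType) : continuous (@sinh R).
Proof.
move=> x; apply: cvgM; last exact: cvg_cst.
apply: cvgB; first exact: continuous_expR.
by apply: (cvg_comp _ expR); [by apply: (@cvgN _ R^o); exact: cvg_id|exact: continuous_expR].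
Qed.

Lemma continuous_tanh (R : realType) : continuous (@tanh R).
Proof.
move=> x; apply: cvgM; first exact: continuous_sinh.
by apply: cvgV; [rewrite gt_eqF// cosh_gt0|exact: continuous_cosh].
Qed.

Lemma tanh0 (R : realType) : tanh (0 : R) = 0.
Proof. by rewrite /tanh /sinh oppr0 subrr mul0r mul0r. Qed.

Lemma tanh_le1 (R : realType) (x : R) : tanh x <= 1.
Proof.
rewrite /tanh ler_pdivrMr ?cosh_gt0// mul1r ler_pM2r//.
by have := expR_gt0 (- x); lra.
Qed.

(** Dominated convergence yields limits along sequences; this turns them into continuity. *)
Lemma cvg_fun_seq (R : realType) (f : R -> R) (x : R) :
  (forall u : nat -> R, u n @[n --> \oo] --> x -> f (u n) @[n --> \oo] --> f x) ->
  {for x, continuous f}.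
Proof. by move=> H; apply/(@cvg_nbhsP _ R^o). Qed.

Lemma le_quadratic_growth (R : realType) (f : R -> R) (A K : R) :
  0 <= A -> 0 <= K -> (forall x, `|f x| <= A + K * x ^+ 2) -> quadratic_growth f.
Proof.
move=> A0 K0 fAK; exists (A + K) => x; apply: (le_trans (fAK x)).
have := sqr_ge0 x; have := mulr_ge0 A0 (sqr_ge0 x).
by lra.
Qed.

Lemma cost_continuous (R : realType) (h : R -> R) : cost_assumption h ->
  [/\ continuous h, continuous (derive1 h) & continuous (derive1n 2 h)].
Proof.
move=> /cost_assumptionP[k [K [_ [dh dh' ch'' _ _]]]].
by split; [move=> z..|exact: ch''];
  apply: differentiable_continuous; exact/derivable1_diffP.
Qed.

Lemma cost_quadratic_growth (R : realType) (h : R -> R) : cost_assumption h ->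
  [/\ quadratic_growth h, quadratic_growth (derive1 h) &
      quadratic_growth (derive1n 2 h)].
Proof.
move=> /cost_assumptionP[k [K [k0 [_ _ _ _ [hkK h'K hK kh]]]]].
have K0 : 0 <= K.
  have /andP[kh0 hK0] := hkK 0.
  by rewrite (le_trans (ltW k0))// (le_trans kh0).
split.
- have hpos x : 0 <= h x.
    by rewrite (le_trans _ (kh x))// mulr_ge0 ?sqr_ge0// divr_ge0// ltW.
  by apply: (le_quadratic_growth (hpos 0) K0) => x; rewrite ger0_norm.
- apply: (le_quadratic_growth K0 K0) => x; apply: le_trans (h'K x) _.
  (* Expanding [(|x| - 1) ^+ 2] bounds [|x|] by [1 + x ^+ 2]. *)
  rewrite -real_normK ?num_real//.
  have := mulr_ge0 K0 (sqr_ge0 (`|x| - 1)); have := mulr_ge0 K0 (normr_ge0 x).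
  by have := normr_ge0 x; nra.
- apply: (le_quadratic_growth K0 (lexx 0)) => x.
  have /andP[kx xK] := hkK x.
  by rewrite mul0r addr0 ger0_norm// (le_trans _ kx)// ltW.
Qed.

(** * Convergence of thresholds and of values on the diagonal *)

Section waiting_value.
Context (d : measure_display) (T : measurableType d) (R : realType).
Context (nu : {measure set T -> \bar R}) (w Y : T -> R).
Hypotheses (mw : measurable_fun [set: T] w) (mY : measurable_fun [set: T] Y).
Hypothesis w_ge0 : forall y, 0 <= w y.
Hypothesis iw : nu.-integrable [set: T] (EFin \o w).
Hypothesis iwY2 : nu.-integrable [set: T] (EFin \o (fun y => w y * Y y ^+ 2)).
Hypothesis w_gt0 : 0 < \int[nu]_y w y.

Context (h : R -> R).
Hypothesis hh : cost_assumption h.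
Hypothesis sym : potential nu w Y (derive1 h) 0 1 = 0.

Let pot := potential nu w Y.
Let h' := derive1 h.
Let h'' := derive1n 2 h.

(** The common form of [p1], at [a = 1], and [pN], at [a = (N - 1) / N]: in the latter the scale is
    [a * sqrt (1 / a) = sqrt a]. *)
Definition scaled_potential (a x : R) := potential nu w Y h (a * x) (Num.sqrt a).
Local Notation P := scaled_potential.

Let ch : continuous h. Proof. by have [] := cost_continuous hh. Qed.
Let ch' : continuous h'. Proof. by have [] := cost_continuous hh. Qed.
Let ch'' : continuous h''. Proof. by have [] := cost_continuous hh. Qed.
Let gh : quadratic_growth h.
Proof. by have [] := cost_quadratic_growth hh. Qed.
Let gh' : quadratic_growth h'.
Proof. by have [] := cost_quadratic_growth hh. Qed.
Let gh'' : quadratic_growth h''.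
Proof. by have [] := cost_quadratic_growth hh. Qed.

Lemma derive1_scaled_potential a :
  derive1 (P a) = fun x => a * pot h' (a * x) (Num.sqrt a).
Proof.
have [k [K [_ [dh _ _ _ _]]]] := cost_assumptionP hh.
apply/funext => x; rewrite derive1E.
by have [_ ->] := is_derive_potential mw mY w_ge0 iw iwY2 a (Num.sqrt a) x
  dh ch' gh gh'.
Qed.

Let dP (a x : R) : derivable (derive1 (P a)) x 1 /\
  derive1n 2 (P a) x = a * (a * pot h'' (a * x) (Num.sqrt a)).
Proof.
have [k [K [_ [_ dh' _ _ _]]]] := cost_assumptionP hh.
have D := is_derive_potential mw mY w_ge0 iw iwY2 a (Num.sqrt a) x
  dh' ch'' gh' gh''.
have D' := is_deriveZ a D.
rewrite /derive1n/= derive1_scaled_potential derive1E; split.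
  by case: D'.
by case: D' => _ ->.
Qed.

Lemma derive1n2_scaled_potential a x :
  derive1n 2 (P a) x = a * (a * pot h'' (a * x) (Num.sqrt a)).
Proof. by case: (dP a x). Qed.

Let pot_h''_ge k b s : (forall x, k <= h'' x) -> k * \int[nu]_y w y <= pot h'' b s.
Proof.
move=> kh; rewrite -(@potential_cst _ _ _ nu w Y iw k b s).
apply: potential_le => //.
- exact: continuous_measurable_fun.
- by exists `|k| => x; rewrite ler_peMr// lerDl sqr_ge0.
Qed.

Let pot_h''_le K b s : (forall x, h'' x <= K) -> pot h'' b s <= K * \int[nu]_y w y.
Proof.
move=> hK; rewrite -(@potential_cst _ _ _ nu w Y iw K b s).
apply: potential_le => //.
- exact: continuous_measurable_fun.
- by exists `|K| => x; rewrite ler_peMr// lerDl sqr_ge0.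
Qed.

Let derive1n2_gt0 (a x : R) : 0 < a -> 0 < derive1n 2 (P a) x.
Proof.
move=> a0; have [k [K [k0 [_ _ _ _ [hkK _ _ _]]]]] := cost_assumptionP hh.
rewrite derive1n2_scaled_potential !mulr_gt0//.
apply: lt_le_trans (pot_h''_ge _ _ (fun x => proj1 (andP (hkK x)))).
by rewrite mulr_gt0.
Qed.

(** The threshold equation cleared of its denominator, which is positive by [derive1n2_gt0]. *)
Let G (beta a x : R) : R := (Num.sqrt beta)^-1 * tanh (x * Num.sqrt beta) * derive1n 2 (P a) x
  - (derive1 (P a) x - 1).

Let thresholdE (beta a x : R) : 0 < a ->
  positive_threshold beta (P a) x <-> 0 < x /\ G beta a x = 0.
Proof.
move=> a0; have P0 := derive1n2_gt0 x a0.
rewrite /positive_threshold /G; split=> -[x0 E]; split => //.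
  by rewrite E divfK ?subrr// gt_eqF.
by move/eqP : E; rewrite subr_eq0 => /eqP <-; rewrite mulfK// gt_eqF.
Qed.

Let cvg_P2 (a b : nat -> R) (a0 b0 : R) :
  a n @[n --> \oo] --> a0 -> b n @[n --> \oo] --> b0 ->
  derive1n 2 (P (a n)) (b n) @[n --> \oo] --> derive1n 2 (P a0) b0.
Proof.
move=> aa bb; under eq_fun do rewrite derive1n2_scaled_potential.
rewrite derive1n2_scaled_potential.
apply: cvgM => //; apply: cvgM => //; apply: cvg_potential => //.
  exact: cvgM.
by apply: (cvg_comp _ Num.sqrt aa); exact: sqrt_continuous.
Qed.

Let cvg_P1 (a b : nat -> R) (a0 b0 : R) :
  a n @[n --> \oo] --> a0 -> b n @[n --> \oo] --> b0 ->
  derive1 (P (a n)) (b n) @[n --> \oo] --> derive1 (P a0) b0.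
Proof.
move=> aa bb; under eq_fun do rewrite derive1_scaled_potential.
rewrite derive1_scaled_potential.
apply: cvgM => //; apply: cvg_potential => //.
  exact: cvgM.
by apply: (cvg_comp _ Num.sqrt aa); exact: sqrt_continuous.
Qed.

(** Constant [b] gives the pointwise convergence of the threshold functions; constant [beta] and [a]
    give the continuity of each. *)
Let cvg_G (beta a b : nat -> R) (beta0 a0 b0 : R) : 0 < beta0 ->
  beta n @[n --> \oo] --> beta0 ->
  a n @[n --> \oo] --> a0 -> b n @[n --> \oo] --> b0 ->
  G (beta n) (a n) (b n) @[n --> \oo] --> G beta0 a0 b0.
Proof.
move=> beta0_gt0 bbeta aa bb.
have sb : Num.sqrt (beta n) @[n --> \oo] --> Num.sqrt beta0.
  by apply: (cvg_comp _ Num.sqrt bbeta); exact: sqrt_continuous.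
apply: cvgB; last by apply: cvgB; [exact: cvg_P1|exact: cvg_cst].
apply: cvgM; last exact: cvg_P2.
apply: cvgM; first by apply: cvgV => //; rewrite gt_eqF// sqrtr_gt0.
have bs : b n * Num.sqrt (beta n) @[n --> \oo] --> b0 * Num.sqrt beta0.
  exact: cvgM.
by apply: (cvg_comp _ (@tanh R) bs); exact: continuous_tanh.
Qed.

Let continuous_G beta a : 0 < beta -> continuous (G beta a).
Proof.
move=> beta0 x; apply: cvg_fun_seq => u ux.
by apply: cvg_G => //; exact: cvg_cst.
Qed.

(** Since [tanh] is at most 1 and the second derivative is bounded, the first term of [G] stays
    bounded, while the first derivative, zero at 0, grows at least linearly. *)
Let G_lt0 beta : 0 < beta -> exists M, forall x, M < x -> G beta 1 x < 0.
Proof.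
move=> beta0; have [k [K [k0 [_ _ _ _ [hkK _ _ _]]]]] := cost_assumptionP hh.
pose m := \int[nu]_y w y; pose s := (Num.sqrt beta)^-1.
have s0 : 0 < s by rewrite invr_gt0 sqrtr_gt0.
have km0 : 0 < k * m by rewrite mulr_gt0.
have P2 x : k * m <= derive1n 2 (P 1) x <= K * m.
  rewrite derive1n2_scaled_potential !mul1r; apply/andP; split.
    by apply: pot_h''_ge => z; have /andP[] := hkK z.
  by apply: pot_h''_le => z; have /andP[] := hkK z.
have P1 x : 0 < x -> k * m * x <= derive1 (P 1) x.
  move=> x0; have [z _] := derivable_mvt (fun z => proj1 (dP 1 z)) x0.
  rewrite [in derive1 (P 1) 0]derive1_scaled_potential mulr0 sqrtr1 /pot sym.
  rewrite mulr0 !subr0 => ->; rewrite ler_wpM2r ?(ltW x0)//.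
  by have /andP[] := P2 z.
(* Beyond this point [k * m * x], a lower bound of the first derivative, exceeds
   [s * (K * m) + 1]. *)
exists (Num.max 0 ((s * (K * m) + 1) / (k * m))) => x.
rewrite gt_max => /andP[x0]; rewrite ltr_pdivrMr// mulrC => Mx.
have {}P1 := P1 x x0; have /andP[P2x P2K] := P2 x.
have : s * tanh (x * Num.sqrt beta) * derive1n 2 (P 1) x <= s * (K * m).
  rewrite -mulrA ler_wpM2l ?(ltW s0)//; apply: le_trans P2K.
  by rewrite ler_piMl ?tanh_le1// (le_trans _ P2x)// ltW.
by rewrite /G -/s; lra.
Qed.

Lemma cvg_waiting_value (beta : R) (c : R) (a cn : nat -> R) : 0 < beta ->
  unique (positive_threshold beta (P 1)) c ->
  (forall n, 0 < a n) -> a n @[n --> \oo] --> (1 : R) ->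
  (forall n, unique (positive_threshold (beta * a n) (P (a n))) (cn n)) ->
  waiting_value (beta * a n) (P (a n)) (cn n) 0 @[n --> \oo] -->
  waiting_value beta (P 1) c 0.
Proof.
move=> beta0 [/(thresholdE _ _ ltr01)[c0 Gc] cuniq] a0 a1 cnuniq.
have bb : beta * a n @[n --> \oo] --> beta.
  by rewrite -[X in _ --> X]mulr1; apply: cvgM => //; exact: cvg_cst.
have ccn : cn n @[n --> \oo] --> (c : R).
  apply: (@cvg_unique_zero R (G beta 1) (fun n => G (beta * a n) (a n))).
  - exact: continuous_G.
  - by move=> n; apply: continuous_G; rewrite mulr_gt0.
  (* The value at 0 is 1, because [tanh 0 = 0] and [sym] makes the first derivative vanish there. *)
  - rewrite /G mul0r tanh0 mulr0 mul0r sub0r derive1_scaled_potential.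
    by rewrite mulr0 sqrtr1 /pot sym mulr0 sub0r opprK.
  - exact: G_lt0.
  - move=> x x0; apply: cvg_G => //; exact: cvg_cst.
  - exact: c0.
  - by move=> x x0 Gx; apply/esym/cuniq/thresholdE.
  - by move=> n x x0 Gx; apply/esym/(cnuniq n).2/thresholdE.
rewrite /waiting_value.
apply: cvgD; last first.
  rewrite /scaled_potential; under eq_fun do rewrite mulr0.
  rewrite mulr0; apply: cvg_potential => //; first exact: cvg_cst.
  by apply: (cvg_comp _ Num.sqrt a1); exact: sqrt_continuous.
apply: cvgM.
  apply: (@cvgN _ R^o); apply: cvgM; first exact: cvg_P2.
  by under eq_fun do rewrite mul0r; rewrite mul0r; exact: cvg_cst.
apply: cvgV; first by rewrite mulf_neq0// gt_eqF// cosh_gt0.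
apply: cvgM => //.
have sb : Num.sqrt (beta * a n) @[n --> \oo] --> Num.sqrt beta.
  by apply: (cvg_comp _ Num.sqrt bb); exact: sqrt_continuous.
have cs : cn n * Num.sqrt (beta * a n) @[n --> \oo] --> c * Num.sqrt beta.
  exact: cvgM.
by apply: (cvg_comp _ (@cosh R) cs); exact: continuous_cosh.
Qed.

End waiting_value.

(** * Integrals and measures modulo null sets, and reflection of the normal law *)

Import HBNNSimple.

(* No measurability of [f] and [g]: the inner integral of [p1] need not be
   measurable, as continuity of the paths is only almost sure. *)
Lemma le_integral_off_null (d : measure_display) (T : measurableType d)
    (R : realType) (mu : {measure set T -> \bar R}) (D : set T)
    (f g : T -> \bar R) :
  measurable D -> mu (~` D) = 0%E ->
  (forall x, 0 <= f x)%E -> (forall x, 0 <= g x)%E ->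
  (forall x, D x -> f x <= g x)%E ->
  (\int[mu]_x f x <= \int[mu]_x g x)%E.
Proof.
move=> mD muD f0 g0 fg.
have sE (s : {nnsfun T >-> R}) : sintegral mu s = (\int[mu]_x (s x)%:E)%E.
  by rewrite integral_nnsfun// patch_setT.
(* The integral is a supremum over simple functions below [f]; cutting such a function off outside
   [D] puts it below [g] without changing its integral. *)
rewrite !ge0_integralTE//; apply: ge_ereal_sup => _ [s /= sf <-].
apply: ereal_sup_ubound; exists (proj_nnsfun s mD) => /=.
  move=> x; rewrite mindicE; have [xD|xD] := boolP (x \in D).
    by rewrite mulr1 (le_trans (sf x))// fg// -inE.
  by rewrite mulr0.
rewrite !sE; apply: ge0_ae_eq_integral => //.
- by apply/measurable_EFinP; exact: measurable_funPT.
- by apply/measurable_EFinP; exact: measurable_funPT.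
- by move=> x _; rewrite lee_fin.
- by move=> x _; rewrite lee_fin.
- exists (~` D); split => //; first exact: measurableC.
  move=> x /=; apply: contra_not => Dx _; rewrite mindicE mem_set//.
  by rewrite mulr1.
Qed.

Lemma eq_integral_off_null (d : measure_display) (T : measurableType d)
    (R : realType) (mu : {measure set T -> \bar R}) (D : set T)
    (f g : T -> \bar R) :
  measurable D -> mu (~` D) = 0%E ->
  (forall x, 0 <= f x)%E -> (forall x, 0 <= g x)%E ->
  (forall x, D x -> f x = g x) ->
  (\int[mu]_x f x = \int[mu]_x g x)%E.
Proof.
move=> mD muD f0 g0 fg; apply/le_anti/andP; split;
  by apply: (le_integral_off_null mD muD) => // x Dx; rewrite fg.
Qed.

Lemma eq_measure_off_null (d : measure_display) (T : measurableType d)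
    (R : realType) (mu : {measure set T -> \bar R}) (D S1 S2 : set T) :
  measurable D -> mu (~` D) = 0%E -> measurable S1 -> measurable S2 ->
  (forall x, D x -> S1 x <-> S2 x) -> mu S1 = mu S2.
Proof.
move=> mD muD m1 m2 S12.
have E S : measurable S -> mu S = mu (S `&` D).
  move=> mS; have S0 : mu (S `\` D) = 0%E.
    apply: (subset_measure0 _ _ _ muD); [exact: measurableD|
      exact: measurableC|exact: subIsetr].
  by have /= -> := measureDI mu mS mD; rewrite [X in (X + _)%E]S0 add0e.
rewrite E// (E S2)//; congr (mu _); apply/seteqP.
by split=> x [Sx Dx]; split => //; apply/S12.
Qed.

(** The centred density is even and Lebesgue measure is invariant under reflection. *)
Lemma normal_probN (R : realType) (s : R) (A : set R) : s != 0 -> measurable A ->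
  normal_prob 0 s (-%R @^-1` A) = normal_prob 0 s A.
Proof.
move=> s0 mA; rewrite /normal_prob.
have mf : measurable_fun [set: R] (fun x : R => (normal_pdf 0 s x)%:E).
  by apply/measurable_EFinP; exact: measurable_normal_pdf.
have fN x : normal_pdf 0 s (- x) = normal_pdf 0 s x.
  by rewrite normal_pdfE// /normal_fun !subr0 sqrrN.
transitivity (\int[lebesgue_measure]_(x in -%R @^-1` A)
    ((fun x : R => (normal_pdf 0 s x)%:E) \o -%R) x)%E.
  by apply: eq_integral => x _ /=; rewrite fN.
rewrite -(@ge0_integral_pushforward _ _ (measurableTypeR R) (measurableTypeR R) R -%R)//=.
- by apply: eq_measure_integral => //= B mB BS; exact: lebesgue_measureN.
- exact: measurable_funTS.
- by move=> x _; rewrite lee_fin normal_pdf_ge0.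
Qed.

(** * Joint measurability and symmetry of Brownian paths *)

(** A preimage is a countable union of rectangles, one for each value of the index. This serves
    paths frozen at grid times. *)
Lemma measurable_countable_family (d : measure_display) (T : measurableType d)
    (R : realType) (X : nat -> T -> R) (k : R -> nat) :
  (forall j, measurable_fun [set: T] (X j)) ->
  (forall j, measurable (k @^-1` [set j])) ->
  measurable_fun [set: T * R] (fun z => X (k z.2) z.1).
Proof.
move=> mX mk _ A mA; rewrite setTI.
rewrite (_ : _ @^-1` A = \bigcup_j ((X j @^-1` A) `*` (k @^-1` [set j]))).
  apply: bigcupT_measurable => j; apply: measurableX; last exact: mk.
  by rewrite -[X in measurable X]setTI; exact: mX.
apply/seteqP; split=> [[w t] /= AX|[w t] [j _ /= [AX kt]]].
  by exists (k t).
by rewrite /= kt.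
Qed.

Lemma measurable_truncn_fiber (R : realType) (c : R) (j : nat) : 0 < c ->
  measurable ((fun t : R => Num.truncn (c * t)) @^-1` [set j]).
Proof.
move=> c0; have m : measurable_fun [set: R] (fun t : R => (Num.truncn (c * t))%:R : R).
  apply: nondecreasing_measurable => // x y xy.
  by rewrite ler_nat le_truncn// ler_pM2l.
have := m measurableT [set j%:R] (measurable_set1 _).
rewrite setTI; congr measurable; apply/seteqP; split => t /=.
  by move=> /eqP; rewrite eqr_nat => /eqP.
by move=> ->.
Qed.

Lemma cvg_truncn_div (R : realType) (t : R) : 0 <= t ->
  (Num.truncn (n.+1%:R * t))%:R / n.+1%:R @[n --> \oo] --> t.
Proof.
move=> t0; apply: (@squeeze_cvgr _ _ _ _ (fun n => t - n.+1%:R^-1) (cst t)); last 2 first.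
- rewrite -[X in _ --> X]subr0; apply: cvgB; first exact: cvg_cst.
  exact: cvg_harmonic.
- exact: cvg_cst.
apply: nearW => n; have n0 : 0 < n.+1%:R :> R by [].
have /truncn_itv/andP[H1 H2] : 0 <= n.+1%:R * t by rewrite mulr_ge0.
apply/andP; split; last by rewrite /= ler_pdivrMr// [leRHS]mulrC.
rewrite ler_pdivlMr// mulrBl mulVf ?gt_eqF// lerBlDr [t * _]mulrC natr1.
exact: ltW.
Qed.

Section brownian_potential.
Context (d : measure_display) (Omega : measurableType d) (R : realType).
Context (P : probability Omega R) (B : R -> {RV P >-> R}).
Hypothesis hB : brownian_motion B.

(** One measurable null set contains both exceptional sets; [D] is its complement. *)
Lemma brownian_regular_set : exists D : set Omega,
  [/\ measurable D, P (~` D) = 0%E, forall w, D w -> B 0 w = 0 &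
      forall w, D w -> {within `[0, +oo[, continuous (fun t => B t w)}].
Proof.
case: hB => B0 _ _ Bc.
have [N [mN PN sub]] := filterI B0 Bc.
exists (~` N); split; [exact: measurableC|by rewrite setCK| |].
  by move=> w Nw; apply: contrapT => Bw; apply: Nw; apply: sub => -[].
by move=> w Nw; apply: contrapT => Bw; apply: Nw; apply: sub => -[].
Qed.

(* Cutting off outside a measurable set of full measure makes the paths jointly
   measurable in (w, t). *)
Definition regular_path (D : set Omega) (z : Omega * R) : R :=
  if (z.1 \in D) && (0 <= z.2) then B z.2 z.1 else 0.

(** The path is the pointwise limit of paths frozen at the last multiple of [1 / (n + 1)] before the
    current time; each of these involves countably many random variables. *)
Lemma measurable_regular_path (D : set Omega) : measurable D ->
  (forall w, D w -> {within `[0, +oo[, continuous (fun t => B t w)}) ->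
  measurable_fun [set: Omega * R] (regular_path D).
Proof.
move=> mD cB.
pose k n (t : R) := Num.truncn (n.+1%:R * t).
pose Yn n (z : Omega * R) := if (z.1 \in D) && (0 <= z.2)
  then B ((k n z.2)%:R / n.+1%:R) z.1 else 0.
have mYn n : measurable_fun [set: Omega * R] (Yn n).
  apply: measurable_fun_ifT.
  - apply: measurable_and.
      apply: (measurable_fun_bool true); rewrite setTI.
      rewrite (_ : _ @^-1` _ = fst @^-1` D).
        by rewrite -[X in measurable X]setTI; exact: measurable_fst.
      by apply/seteqP; split=> z /=; [move/set_mem|move/mem_set].
    by apply: measurable_fun_ler => //; exact: measurable_snd.
  - apply: (@measurable_countable_family _ _ _ (fun j => B (j%:R / n.+1%:R) : Omega -> R) (k n)).
      by move=> j; exact: measurable_funPT.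
    by move=> j; exact: measurable_truncn_fiber.
  - exact: measurable_cst.
apply: (measurable_fun_cvg mYn) => -[w t] _ /=.
rewrite /Yn /regular_path /=; case: ifPn => [/andP[wD t0]|_]; last exact: cvg_cst.
have /subspace_continuousP/(_ t) H := cB w (set_mem wD).
have {}H := H ltac:(by rewrite /= in_itv/= t0).
(* The grid times are nonnegative, so they approach [t] within the half-line on which the path is
   continuous. *)
apply: (cvg_comp _ (fun t => B t w) _ H).
move=> U /= [e e0 He]; have /cvgrPdist_lt/(_ e e0) := cvg_truncn_div t0.
apply: filterS => n Hn; apply: He => //=.
by rewrite in_itv/= andbT divr_ge0.
Qed.

Lemma brownian_lawN (D : set Omega) (t : R) (A : set R) :
  measurable D -> P (~` D) = 0%E -> (forall w, D w -> B 0 w = 0) ->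
  (forall w, D w -> {within `[0, +oo[, continuous (fun t => B t w)}) ->
  measurable A ->
  P [set w | A (- regular_path D (w, t))] = P [set w | A (regular_path D (w, t))].
Proof.
move=> mD PD B0 cB mA.
have mY := measurable_regular_path mD cB.
have mYt : measurable_fun [set: Omega] (fun w => regular_path D (w, t)).
  exact: (measurableT_comp mY (pair2_measurable t)).
have mAN : measurable (-%R @^-1` A : set R).
  by rewrite -[X in measurable X]setTI; exact: oppr_measurable.
have mpre (C : set R) : measurable C -> measurable [set w | C (regular_path D (w, t))].
  by move=> mC; rewrite -[X in measurable X]setTI; exact: mYt.
(* The normal law is given for increments over a positive time only; for [t <= 0] the regular path
   is 0. *)
have [t0|t0] := leP t 0.
  suff Y0 w : regular_path D (w, t) = 0 by congr (P _); apply/seteqP; split=> w /=; rewrite Y0 oppr0.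
  rewrite /regular_path/=; case: ifPn => // /andP[/set_mem wD t0'].
  by rewrite (_ : t = 0) ?B0//; apply/le_anti; rewrite t0 t0'.
have E C : measurable C ->
    P [set w | C (regular_path D (w, t))] = normal_prob 0 (Num.sqrt t) C.
  move=> mC; case: hB => _ _ /(_ 0 t C (lexx 0) t0 mC) + _; rewrite subr0 => <-.
  apply: (eq_measure_off_null mD PD) => //; first exact: mpre.
    rewrite -[X in measurable X]setTI; apply: measurable_funB => //;
      exact: measurable_funPT.
  by move=> w Dw /=; rewrite /regular_path/= mem_set//= (ltW t0) B0// subr0.
rewrite -[LHS]/(P [set w | (-%R @^-1` A) (regular_path D (w, t))]) !E//.
by apply: normal_probN => //; rewrite gt_eqF// sqrtr_gt0.
Qed.

End brownian_potential.

(** * Potentials as integrals against a product measure *)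

Definition discount (R : realType) (alpha t : R) : R :=
  if 0 <= t then expR (- (alpha * t)) else 0.

Lemma discount_ge0 (R : realType) (alpha t : R) : 0 <= discount alpha t.
Proof. by rewrite /discount; case: ifP => // _; exact: expR_ge0. Qed.

(** The comparison with the exponential density supplies both measurability and the total mass
    [alpha^-1]. *)
Lemma discountE (R : realType) (alpha t : R) : alpha != 0 ->
  discount alpha t = alpha^-1 * exponential_pdf alpha t.
Proof.
move=> a0; rewrite /discount; have [t0|t0] := leP 0 t.
  by rewrite exponential_pdfE// mulKf// mulNr.
by rewrite lt0_exponential_pdf// mulr0.
Qed.

Lemma measurable_discount (R : realType) (alpha : R) : alpha != 0 ->
  measurable_fun [set: R] (discount alpha).
Proof.
move=> a0; rewrite (_ : discount alpha = fun t => alpha^-1 * exponential_pdf alpha t).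
  by apply: measurable_funM => //; exact: measurable_exponential_pdf.
by apply/funext => t; rewrite discountE.
Qed.

Lemma integral_discount (R : realType) (alpha : R) : 0 < alpha ->
  (\int[lebesgue_measure]_t (discount alpha t)%:E = alpha^-1%:E)%E.
Proof.
move=> a0; under eq_integral do rewrite discountE ?gt_eqF// EFinM.
rewrite ge0_integralZl//; last 3 first.
- by apply/measurable_EFinP; exact: measurable_exponential_pdf.
- by move=> t _; rewrite lee_fin exponential_pdf_ge0// ltW.
- by rewrite lee_fin invr_ge0 ltW.
by rewrite integral_exponential_pdf// mule1.
Qed.

(** All that is needed later about Brownian motion: a Tonelli representation and the symmetry of [Y]
    under the weight. Nonnegative [f] are treated without any integrability. *)
Lemma brownian_potential_measure (d : measure_display)
    (Omega : measurableType d) (R : realType) (P : probability Omega R)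
    (B : R -> {RV P >-> R}) (alpha : R) : brownian_motion B -> 0 < alpha ->
  exists (d' : measure_display) (T : measurableType d')
    (nu : {measure set T -> \bar R}) (w Y : T -> R),
  [/\ measurable_fun [set: T] w, measurable_fun [set: T] Y,
      forall z, 0 <= w z, nu.-integrable [set: T] (EFin \o w) &
      0 < \int[nu]_z w z] /\
  [/\ forall (f : R -> R) (b s : R), continuous f -> (forall x, 0 <= f x) ->
        (\int[P]_w \int[lebesgue_measure]_(t in `[0%R, +oo[)
           (expR (- (alpha * t)) * f (b + s * B t w))%:E =
         \int[nu]_z (w z * f (b + s * Y z))%:E)%E &
      forall f : R -> R, continuous f -> (forall x, 0 <= f x) ->
        (\int[nu]_z (w z * f (Y z))%:E = \int[nu]_z (w z * f (- Y z))%:E)%E].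
Proof.
move=> hB a0; have [D [mD PD B0 cB]] := brownian_regular_set hB.
pose nu : {measure set _ -> \bar R} := (P \x (@lebesgue_measure R))%E.
pose w (z : Omega * R) := discount alpha z.2.
pose Y := regular_path B D.
have mY : measurable_fun [set: Omega * R] Y := measurable_regular_path mD cB.
have mw : measurable_fun [set: Omega * R] w.
  by apply: (measurableT_comp (measurable_discount _) measurable_snd); rewrite gt_eqF.
have w0 z : 0 <= w z by exact: discount_ge0.
have nuw : (\int[nu]_z (w z)%:E = alpha^-1%:E)%E.
  rewrite /nu fubini_tonelli1; last 2 first.
  - exact/measurable_EFinP.
  - by move=> z; rewrite lee_fin.
  - rewrite /fubini_F /w /=.
    under eq_integral do rewrite integral_discount//.
    by rewrite integral_cst// [X in (_ * X)%E]probability_setT mule1.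
have mwf (g : Omega * R -> R) (f : R -> R) : measurable_fun [set: Omega * R] g ->
    continuous f -> measurable_fun [set: Omega * R] (fun z => (w z * f (g z))%:E).
  move=> mg cf; apply/measurable_EFinP; apply: measurable_funM => //.
  exact: (measurableT_comp (continuous_measurable_fun cf)).
exists _, _, nu, w, Y; split; split => //.
- apply/integrableP; split; first exact/measurable_EFinP.
  under eq_integral do rewrite /= ger0_norm//.
  by rewrite nuw ltry.
- by rewrite /Rintegral nuw /= invr_gt0.
- move=> f b s cf f0; rewrite /nu fubini_tonelli1; last 2 first.
  + apply: (mwf (fun z => b + s * Y z)) => //.
    by apply: measurable_funD => //; exact: measurable_funM.
  + by move=> z; rewrite lee_fin mulr_ge0.
  (* On [D] and for [t >= 0] the regular path is [B]; elsewhere in time the discount vanishes. *)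
  apply: (eq_integral_off_null mD PD).
  + by move=> x; apply: integral_ge0 => t _; rewrite lee_fin mulr_ge0 ?expR_ge0.
  + by move=> x; apply: integral_ge0 => t _; rewrite lee_fin mulr_ge0.
  move=> x Dx; rewrite integral_mkcond; apply: eq_integral => t _.
  rewrite patchE /w /Y /regular_path /discount /= mem_setE in_itv/= andbT mem_set//=.
  by case: ifP => // _; rewrite mul0r.
(* Integrating over [Omega] first fixes [t], so the symmetry of the law at time [t] applies
   inside. *)
- move=> f cf f0; rewrite /nu !fubini_tonelli2; last 4 first.
  + by apply: (mwf (fun z => - Y z)) => //; exact: measurable_funN.
  + by move=> z; rewrite lee_fin mulr_ge0.
  + exact: mwf.
  + by move=> z; rewrite lee_fin mulr_ge0.
  apply: eq_integral => t _; rewrite /fubini_G /w/=.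
  have mYt : measurable_fun [set: Omega] (fun w => Y (w, t)).
    exact: (measurableT_comp mY (pair2_measurable t)).
  have mNYt : measurable_fun [set: Omega] (fun w => - Y (w, t)).
    exact: measurable_funN.
  pose g (y : R) := (discount alpha t * f y)%:E.
  have mg : measurable_fun [set: R] g.
    apply/measurable_EFinP; apply: measurable_funM => //.
    exact: continuous_measurable_fun.
  have g0 y : (0 <= g y)%E by rewrite lee_fin mulr_ge0// discount_ge0.
  transitivity (\int[pushforward P (fun w => Y (w, t))]_y g y)%E.
    by rewrite ge0_integral_pushforward.
  transitivity (\int[pushforward P (fun w => - Y (w, t))%R]_y g y)%E; last first.
    by rewrite ge0_integral_pushforward.
  apply: eq_measure_integral => A mA _.
  exact/esym/(brownian_lawN hB t mD PD B0 cB mA).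
Qed.

(** * Vanishing of odd potentials and the second moment *)

(** Symmetry is available for nonnegative functions. With [g] the positive part of the odd [f], the
    negative part is [g (- x)], and both have the same potential. *)
Lemma potential_odd_eq0 (d : measure_display) (T : measurableType d)
    (R : realType) (nu : {measure set T -> \bar R}) (w Y : T -> R)
    (f : R -> R) :
  measurable_fun [set: T] w -> measurable_fun [set: T] Y ->
  (forall y, 0 <= w y) ->
  nu.-integrable [set: T] (EFin \o w) ->
  nu.-integrable [set: T] (EFin \o (fun y => w y * Y y ^+ 2)) ->
  (forall g : R -> R, continuous g -> (forall x, 0 <= g x) ->
     (\int[nu]_z (w z * g (Y z))%:E = \int[nu]_z (w z * g (- Y z))%:E)%E) ->
  continuous f -> quadratic_growth f -> (forall x, f (- x) = - f x) ->
  potential nu w Y f 0 1 = 0.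
Proof.
move=> mw mY w0 iw iwY2 sym cf [C fC] fodd.
pose g x := Num.max (f x) 0.
have cg : continuous g.
  by move=> x; apply: continuous_max => //; [exact: cf|exact: cvg_cst].
have gg : quadratic_growth g.
  exists C => x; apply: le_trans (fC x); rewrite /g.
  by case: (leP (f x) 0) => fx; rewrite ?normr0.
have ig s := integrable_potential mw mY w0 iw iwY2 0 s (continuous_measurable_fun cg) gg.
have fg x : f x = g x - g (- x).
  rewrite /g fodd; case: (leP (f x) 0) => fx; case: (leP (- f x) 0) => fx'; lra.
have E : potential nu w Y f 0 1 = potential nu w Y g 0 1 - potential nu w Y g 0 (-1).
  rewrite /potential -RintegralB//; apply: eq_Rintegral => y _.
  by rewrite !add0r mul1r mulN1r fg mulrBr.
rewrite E; apply/eqP; rewrite subr_eq0; apply/eqP.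
rewrite /potential /Rintegral; congr fine.
under eq_integral do rewrite add0r mul1r.
under [RHS]eq_integral do rewrite add0r mulN1r.
by apply: sym => // x; rewrite le_max lexx orbT.
Qed.

(* If [p] vanished identically, as [p1] would were its integrals infinite, the
   right-hand side of the threshold equation would be (0 - 1) / 0, that is [0].
   So the existence of a threshold yields the second moment of [Y]. *)
Lemma positive_threshold_neq0 (R : realType) (beta : R) (p : R -> R) (c : R) :
  0 < beta -> positive_threshold beta p c -> exists x, p x != 0.
Proof.
move=> beta0 [c0 E]; apply: contrapT => /forallNP p0.
have {}p0 : p = cst 0 by apply/funext => x; apply/eqP/negPn/negP/p0.
have s0 : 0 < Num.sqrt beta by rewrite sqrtr_gt0.
have : 0 < (Num.sqrt beta)^-1 * tanh (c * Num.sqrt beta).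
  rewrite mulr_gt0 ?invr_gt0// divr_gt0 ?cosh_gt0// divr_gt0// subr_gt0 ltr_expR.
  by have := mulr_gt0 c0 s0; lra.
rewrite E p0 /derive1n/= (_ : derive1 (cst 0) = cst 0); last first.
  by apply/funext => x; rewrite derive1_cst.
by rewrite derive1_cst invr0 mulr0 ltxx.
Qed.

Lemma integrable_sqr_of_cost (d : measure_display) (T : measurableType d)
    (R : realType) (nu : {measure set T -> \bar R}) (w Y : T -> R)
    (h : R -> R) (b k : R) :
  measurable_fun [set: T] w -> measurable_fun [set: T] Y ->
  (forall y, 0 <= w y) -> nu.-integrable [set: T] (EFin \o w) ->
  measurable_fun [set: R] h -> 0 < k -> (forall x, k * x ^+ 2 <= h x) ->
  (\int[nu]_z (w z * h (b + Y z))%:E)%E \is a fin_num ->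
  nu.-integrable [set: T] (EFin \o (fun y => w y * Y y ^+ 2)).
Proof.
move=> mw mY w0 iw mh k0 kh fin.
have h0 x : 0 <= h x by rewrite (le_trans _ (kh x))// mulr_ge0 ?sqr_ge0// ltW.
have ih : nu.-integrable [set: T] (EFin \o (fun y => w y * h (b + Y y))).
  apply/integrableP; split.
    apply/measurable_EFinP; apply: measurable_funM => //.
    by apply: (measurableT_comp mh); exact: measurable_funD.
  under eq_integral do rewrite /= ger0_norm ?mulr_ge0//.
  by rewrite -ge0_fin_numE// integral_ge0// => y _; rewrite lee_fin mulr_ge0.
(* The majorant comes from [Y ^+ 2 <= 2 * (b + Y) ^+ 2 + 2 * b ^+ 2] and
   [(b + Y) ^+ 2 <= k^-1 * h (b + Y)]. *)
have iG : nu.-integrable [set: T]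
    (fun y => (2 / k)%:E * (w y * h (b + Y y))%:E + (2 * b ^+ 2)%:E * (w y)%:E)%E.
  by apply: integrableD => //; exact: integrableZl.
apply: (le_integrable _ _ _ iG) => //.
  apply/measurable_EFinP; apply: measurable_funM => //.
  exact: measurable_funX.
move=> y _ /=; rewrite lee_fin ger0_norm ?(mulr_ge0 (w0 y) (sqr_ge0 _))//.
apply: le_trans (ler_norm _).
have H := kh (b + Y y).
have H1 : (b + Y y) ^+ 2 <= k^-1 * h (b + Y y) by rewrite ler_pdivlMl.
have : Y y ^+ 2 <= 2 * (k^-1 * h (b + Y y)) + 2 * b ^+ 2.
  by have := sqr_ge0 (Y y + 2 * b); nra.
move=> /(ler_wpM2l (w0 y)) /le_trans; apply.
by rewrite le_eqVlt; apply/orP; left; apply/eqP; ring.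
Qed.

(** * The limit along the number of players *)

Lemma cvg_natS_div (R : realType) :
  (n.+2%:R - 1) / n.+2%:R @[n --> \oo] --> (1 : R).
Proof.
rewrite (_ : (fun n : nat => _) = (fun n : nat => 1 - n.+2%:R^-1 : R)); last first.
  by apply/funext => n; rewrite mulrBl mul1r divff.
rewrite -[X in _ --> X]subr0; apply: cvgB; first exact: cvg_cst.
by have := @cvg_harmonic R; rewrite -(cvg_shiftS (@harmonic R)).
Qed.

(** The number of players is [n.+2], hence at least 2; [inord i] is player [i] as soon as
    [i < n.+2], so for all but finitely many [n]. *)
Theorem proposition12 (R : realType) (d : measure_display)
    (Omega : measurableType d) (P : probability Omega R)
    (B : R -> {RV P >-> R}) (hB : brownian_motion B)
    (h : R -> R) (hh : cost_assumption h)
    (alpha : R) (halpha : 0 < alpha)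
    (c : R) (hc : unique (positive_threshold (2 * alpha) (p1 B alpha h)) c)
    (cN : nat -> R)
    (hcN : forall N : nat, (2 <= N)%N ->
       unique (positive_threshold (rateN alpha N) (pN B alpha h N)) (cN N))
    (vN : forall N : nat, 'I_N -> 'rV[R]_N -> R)
    (hvN : forall (N : nat) (i : 'I_N) (y : 'rV[R]_N), (2 <= N)%N ->
       waiting_region (cN N) y ->
       vN N i y
       = waiting_value (rateN alpha N) (pN B alpha h N) (cN N) (gap y i))
    (x : R) (i : nat) :
  vN n.+2 (inord i) (const_mx x) @[n --> \oo]
  --> mfg_value alpha (p1 B alpha h) c (dirac x) x.
Proof.
have [d' [T [nu [w [Y [[mw mY w0 iw wpos] [rep sym]]]]]]] :=
  brownian_potential_measure hB halpha.
have [k [K [k0 [_ _ _ h'odd [_ _ _ kh]]]]] := cost_assumptionP hh.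
have [ch ch' _] := cost_continuous hh.
have [_ gh' _] := cost_quadratic_growth hh.
have h0 z : 0 <= h z.
  by rewrite (le_trans _ (kh z))// mulr_ge0 ?sqr_ge0// divr_ge0// ltW.
pose P' := scaled_potential nu w Y h.
have p1E : p1 B alpha h = P' 1.
  apply/funext => z; rewrite /P' /scaled_potential /potential /Rintegral /p1.
  rewrite -(rep _ _ _ ch h0); congr fine; apply: eq_integral => o _; apply: eq_integral => t _.
  by rewrite sqrtr1 !mul1r.
pose a n : R := (n.+2%:R - 1) / n.+2%:R.
have a0 n : 0 < a n by rewrite divr_gt0// subr_gt0 ltr1n.
have pNE n : pN B alpha h n.+2 = P' (a n).
  apply/funext => z; rewrite /P' /scaled_potential /potential /Rintegral /pN.
  rewrite -(rep _ _ _ ch h0); congr fine; apply: eq_integral => o _; apply: eq_integral => t _.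
  (* The scale becomes [a n * sqrt ((a n)^-1) = sqrt (a n)]. *)
  rewrite -/(a n) (_ : n.+2%:R / (n.+2%:R - 1) = (a n)^-1); last by rewrite invf_div.
  rewrite mulrDr mulrA sqrtrV ?(ltW (a0 n))//.
  rewrite -{2}(sqr_sqrtr (ltW (a0 n))) expr2 mulfK// gt_eqF// sqrtr_gt0//.
have rateE n : rateN alpha n.+2 = 2 * alpha * a n.
  by rewrite /rateN /a; ring.
have iwY2 : nu.-integrable [set: T] (EFin \o (fun y => w y * Y y ^+ 2)).
  have beta0 : 0 < 2 * alpha by rewrite mulr_gt0.
  have [z] := positive_threshold_neq0 beta0 hc.1.
  rewrite p1E /P' /scaled_potential /potential /Rintegral => z0.
  apply: (@integrable_sqr_of_cost _ _ _ nu w Y h z (k / 4)) => //.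
  - exact: continuous_measurable_fun.
  - by rewrite divr_gt0.
  (* An infinite integral would be sent to 0 by [fine], against [z0]. *)
  - move: z0; under eq_integral do rewrite sqrtr1 !mul1r.
    by case: (integral _ _ _) => //=; rewrite eqxx.
have sym0 := potential_odd_eq0 mw mY w0 iw iwY2 sym ch' gh' h'odd.
have mE : mean (dirac x) = x.
  by rewrite /mean /Rintegral integral_dirac// diracT mul1e.
(* At [x], the mean of the Dirac mass, both conditionals select the waiting value at distance 0, as
   [c > 0]. *)
rewrite /mfg_value /mfg_value_right mE lexx lerDl (ltW hc.1.1) subrr p1E.
apply: (@cvg_trans _ (waiting_value (2 * alpha * a n) (P' (a n)) (cN n.+2) 0 @[n --> \oo])).
  apply: near_eq_cvg; apply: nearW => n.
  (* The [n.+1] other players all sit at [x], so the gap is 0 and the diagonal lies in the waiting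
     region. *)
  have gap0 l : gap (const_mx x : 'rV[R]_n.+2) l = 0.
    rewrite /gap mxE; under eq_bigr do rewrite mxE.
    rewrite sumr_const (_ : #|_| = n.+1); last first.
      by rewrite cardC1 card_ord.
    rewrite -[n.+2%:R]natr1 addrK -[x *+ _]mulr_natr mulfK ?subrr// pnatr_eq0.
  rewrite hvN//; first by rewrite gap0 rateE pNE.
  by move=> l; rewrite gap0 normr0; have [[]] := hcN n.+2 isT.
have beta0 : 0 < 2 * alpha by rewrite mulr_gt0.
rewrite p1E in hc.
have hcN' n : unique (positive_threshold (2 * alpha * a n) (P' (a n))) (cN n.+2).
  by rewrite -rateE -pNE; exact: hcN.
exact: (@cvg_waiting_value _ _ _ nu w Y mw mY w0 iw iwY2 wpos h hh sym0
  (2 * alpha) c a (fun n => cN n.+2) beta0 hc a0 (@cvg_natS_div R) hcN').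
Qed.
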